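(* Let $R\in\mathbb{R}^{d\times d}$ be constant with $R=R^\top\succeq0$, let $\mathcal{X}\subset\mathbb{R}^d$, and let $\mathcal{H}\in C^2(\mathcal{X},\mathbb{R})$. Let $r:\mathbb{R}\to\mathbb{R}$ be a rational function with no poles on $(-\infty,0]$. Suppose that $r(z)=\exp(z)+O(z^2)$ as $z\to0$ and $r(z)\ge0$ for all $z\le0$. Then, with $$Z(x,h)=-\frac{h^2}{12}R\,\nabla^2\mathcal{H}(x)\,R\,\nabla^2\mathcal{H}(x),$$ the matrix function $$\overline R_{\mathrm{rat}}(x,y,h)=r\big(Z(\tfrac{x+y}{2},h)\big)\,R$$ is a fourth-order symmetric positive semi-definite completion of $$\widetilde R(x,y,h)=R-\frac{h^2}{12}R\,\nabla^2\mathcal{H}(\tfrac{x+y}{2})\,R\,\nabla^2\mathcal{H}(\tfrac{x+y}{2})\,R.$$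
   Context: The matrices arise from the purely dissipative system $\dot x=-R\nabla\mathcal{H}(x)$. All functions of $(x,y)$ are considered for pairs $(x,y)\in\mathcal{X}\times\mathcal{X}$ with $\tfrac{x+y}{2}\in\mathcal{X}$; $\nabla^2\mathcal{H}$ is the (symmetric) Hessian. For a rational function $r=p/q$ in lowest terms and a square matrix $M$ with $q(M)$ invertible, $r(M)=q(M)^{-1}p(M)$. A fourth-order symmetric positive semi-definite completion of $\widetilde R$ is a (well-defined) matrix function $\overline R$ with $\overline R(x,y,h)=\overline R(x,y,h)^\top\succeq0$ for all $(x,y)$ and all $h>0$, and $\overline R=\widetilde R+O(h^4)$ as $h\to0$ (locally uniformly in $(x,y)$). *)

(* Defs.v *)
From HB Require Import structures.
From mathcomp Require Import all_boot all_order all_algebra.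
From mathcomp Require Import all_classical all_reals all_analysis.

Set Implicit Arguments.
Unset Strict Implicit.
Unset Printing Implicit Defensive.

Import Order.TTheory GRing.Theory Num.Theory numFieldNormedType.Exports.

Local Open Scope classical_set_scope.
Local Open Scope ring_scope.

(* The dimension is [n.+1], as required by [horner_mx]. *)

Definition psdmx (K : realType) (m : nat) (A : 'M[K]_m) : Prop :=
  forall v : 'cV[K]_m, 0 <= (v^T *m A *m v) 0 0.

Definition partial (K : realType) (n : nat) (i : 'I_n.+1)
    (f : 'cV[K]_n.+1 -> K) (x : 'cV[K]_n.+1) : K :=
  'D_(delta_mx i 0) f x.

Definition hessian (K : realType) (n : nat) (H : 'cV[K]_n.+1 -> K)
    (x : 'cV[K]_n.+1) : 'M[K]_n.+1 :=
  \matrix_(i, j) partial i (partial j H) x.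

Definition C2_open (K : realType) (n : nat) (U : set 'cV[K]_n.+1)
    (H : 'cV[K]_n.+1 -> K) : Prop :=
  forall x, U x ->
    [/\ {for x, continuous H},
        forall i : 'I_n.+1, derivable H x (delta_mx i 0),
        forall i : 'I_n.+1, {for x, continuous (partial i H)},
        forall i j : 'I_n.+1, derivable (partial j H) x (delta_mx i 0) &
        forall i j : 'I_n.+1, {for x, continuous (partial i (partial j H))}].

(* [X] need not be open: [H] is C^2 on a neighbourhood of [X]. For open [X]
   this is the usual notion (take [U := X]); only the values of the total
   function [H] on [U] matter. *)
Definition C2_on (K : realType) (n : nat) (X : set 'cV[K]_n.+1)
    (H : 'cV[K]_n.+1 -> K) : Prop :=
  exists U : set 'cV[K]_n.+1, [/\ open U, X `<=` U & C2_open U H].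

Definition midpoint (K : realType) (n : nat) (x y : 'cV[K]_n.+1) :
    'cV[K]_n.+1 :=
  2^-1 *: (x + y).

Definition admissible (K : realType) (n : nat) (X : set 'cV[K]_n.+1) :
    set ('cV[K]_n.+1 * 'cV[K]_n.+1) :=
  [set z | [/\ X z.1, X z.2 & X (midpoint z.1 z.2)]].

Definition ratfun (K : realType) (p q : {poly K}) (z : K) : K :=
  p.[z] / q.[z].

(* Meaningful only when [horner_mx M q \in unitmx]. *)
Definition ratmx (K : realType) (n : nat) (p q : {poly K}) (M : 'M[K]_n.+1) :
    'M[K]_n.+1 :=
  invmx (horner_mx M q) *m horner_mx M p.

Definition Zmx (K : realType) (n : nat) (R : 'M[K]_n.+1)
    (H : 'cV[K]_n.+1 -> K) (x : 'cV[K]_n.+1) (h : K) : 'M[K]_n.+1 :=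
  - (h ^+ 2 / 12%:R) *: (R *m hessian H x *m R *m hessian H x).

Definition Rtilde (K : realType) (n : nat) (R : 'M[K]_n.+1)
    (H : 'cV[K]_n.+1 -> K) (x y : 'cV[K]_n.+1) (h : K) : 'M[K]_n.+1 :=
  R - (h ^+ 2 / 12%:R) *: (R *m hessian H (midpoint x y) *m R
                             *m hessian H (midpoint x y) *m R).

Definition Rrat (K : realType) (n : nat) (p q : {poly K}) (R : 'M[K]_n.+1)
    (H : 'cV[K]_n.+1 -> K) (x y : 'cV[K]_n.+1) (h : K) : 'M[K]_n.+1 :=
  ratmx p q (Zmx R H (midpoint x y) h) *m R.

(* O(h^4) as h -> 0+, locally uniformly in [(x, y)] over [D]: around each point
   of [D] one constant [C] and one range of [h] serve a whole relative
   neighbourhood ([\forall .. & ..] is the product filter). *)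
Definition locally_uniform_O4 (K : realType) (n : nat)
    (D : set ('cV[K]_n.+1 * 'cV[K]_n.+1))
    (E : 'cV[K]_n.+1 -> 'cV[K]_n.+1 -> K -> 'M[K]_n.+1) : Prop :=
  forall z0, D z0 -> exists C : K,
    \forall z \near within D (nbhs z0) & h \near 0^'+,
      `|E z.1 z.2 h| <= C * h ^+ 4.

Definition sym_psd_completion4 (K : realType) (n : nat)
    (X : set 'cV[K]_n.+1)
    (Rt Rb : 'cV[K]_n.+1 -> 'cV[K]_n.+1 -> K -> 'M[K]_n.+1) : Prop :=
  (forall x y h, admissible X (x, y) -> 0 < h ->
     Rb x y h = (Rb x y h)^T /\ psdmx (Rb x y h)) /\
  locally_uniform_O4 (admissible X) (fun x y h => Rb x y h - Rt x y h).

(* Main.v *)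
Require Import Defs.
From HB Require Import structures.
From mathcomp Require Import all_boot all_order all_algebra.
From mathcomp Require Import all_classical all_reals all_analysis.
From mathcomp Require Import ring lra.
From mathcomp Require Import complex.

(** Put [S] for the Hessian at the midpoint, [c = h^2 / 12] and
    [Z = - c R S R S]. The matrix [Z] is not symmetric, but [Z R = R Z^T], and
    this passes to every polynomial in [Z] and to [r(Z)]; so [r(Z) R] is
    symmetric ([ratmx_mul_sym]). This uses the symmetry of [S], which for a C^2
    function is Schwarz's theorem ([mixed_derivatives_commute], [hessian_sym]).

    Positivity and invertibility come from a Hermitian model. Over the complex
    numbers [R = L L^*] and [Z L = L (- c B^2)], where [B = L^* S L] is Hermitian
    ([hermitian_model]). The eigenvalues of [- c B^2] are real and nonpositive,
    so the spectral theorem turns sign conditions on a polynomial over the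
    negative half-line into matrix statements: [f(Z)] is invertible if [f] has no
    zero there ([horner_unit]), and [f(Z) R] is positive semi-definite if [f] is
    nonnegative there ([horner_psd]). The first applies to [q]. Since
    [r(Z) R = q(Z)^-1 ((p q)(Z) R) q(Z)^-T], the second applied to
    [p q = r q^2] gives the positivity of [r(Z) R] ([ratmx_mul_psd]).

    For the order, [r = exp + O(z^2)] forces [p = q (1 + X) + s X^2] for some
    polynomial [s] ([ratfun_taylor]), so [r(Z) - 1 - Z = q(Z)^-1 s(Z) Z^2], which
    is [O(|Z|^2)] for small [Z] ([ratmx_remainder]). The matrix [(1 + Z) R] is
    the matrix to be completed, and [|Z| <= b h^2] with [b] uniform near a given
    pair of points because the Hessian is continuous ([hessian_bounded]). *)

Import Order.TTheory GRing.Theory Num.Theory numFieldNormedType.Exports.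

Local Open Scope classical_set_scope.
Local Open Scope ring_scope.

Set Implicit Arguments.
Unset Strict Implicit.
Unset Printing Implicit Defensive.

(** * Polynomials evaluated at matrices *)

(** Polynomial calculus commutes with intertwiners. Here [L] is not invertible
    in general, so this is what stands in for conjugation by [L]. *)
Lemma horner_mx_intertwine (F : comNzRingType) (n : nat)
    (A B L : 'M[F]_n.+1) (f : {poly F}) :
  A *m L = L *m B -> horner_mx A f *m L = L *m horner_mx B f.
Proof.
move=> AL; elim/poly_ind: f => [|f c IH]; first by rewrite !rmorph0 mul0mx mulmx0.
rewrite !rmorphD !rmorphM /= !horner_mx_X !horner_mx_C mulmxDl mulmxDr.
by rewrite scalar_mxC -[X in X + _ = _]mulmxA AL mulmxA IH mulmxA.
Qed.

Lemma horner_mx_comp (F : comNzRingType) (n : nat) (A : 'M[F]_n.+1)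
    (f g : {poly F}) : horner_mx A (f \Po g) = horner_mx (horner_mx A g) f.
Proof.
elim/poly_ind: f => [|f c IH]; first by rewrite comp_poly0 !rmorph0.
by rewrite comp_polyD comp_polyM comp_polyX comp_polyC !rmorphD !rmorphM /=
  !horner_mx_X !horner_mx_C IH.
Qed.

Lemma horner_mx_tr (F : comNzRingType) (n : nat) (A : 'M[F]_n.+1) (f : {poly F}) :
  (horner_mx A f)^T = horner_mx A^T f.
Proof.
elim/poly_ind: f => [|f c IH]; first by rewrite !rmorph0 trmx0.
rewrite !rmorphD !rmorphM /= !horner_mx_X !horner_mx_C linearD /= trmx_mul IH.
by rewrite tr_scalar_mx; congr (_ + _); exact: comm_mx_horner.
Qed.

Lemma horner_mx0 (F : comNzRingType) n (f : {poly F}) :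
  horner_mx (0 : 'M[F]_n.+1) f = f.[0]%:M.
Proof.
elim/poly_ind: f => [|f c IH]; first by rewrite rmorph0 horner0 raddf0.
by rewrite !rmorphD !rmorphM /= horner_mx_X horner_mx_C !hornerE ?mulr0 ?add0r.
Qed.

(** * Functional calculus of Hermitian matrices *)

Section Hermitian.
Variable C : numClosedFieldType.
Local Open Scope sesquilinear_scope.

Lemma trmxCM m n k (A : 'M[C]_(m, n)) (B : 'M[C]_(n, k)) :
  (A *m B)^t* = B^t* *m A^t* .
Proof. by rewrite trmx_mul map_mxM. Qed.

(** The spectral theorem with its unitary factor written through conjugate
    transposes, which is the form that quadratic forms consume. *)
Lemma hermitian_spectral n (A : 'M[C]_n) : A^t* = A ->
  exists (P : 'M[C]_n) (D : 'rV[C]_n), [/\ P^t* *m P = 1%:M, P *m P^t* = 1%:M,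
    forall i, D 0 i \is Num.real & A = P^t* *m diag_mx D *m P].
Proof.
move=> AH; have Aherm : A \is hermsymmx.
  by apply/is_hermitianmxP; rewrite expr0 scale1r AH.
have PU := spectral_unitarymx A; have Punit := spectral_unit A.
exists (spectralmx A), (spectral_diag A); split.
- by rewrite -invmx_unitary// mulVmx.
- by rewrite -invmx_unitary// mulmxV.
- move=> i; have /mxOverP := hermitian_spectral_diag_real Aherm; exact.
- by rewrite -invmx_unitary//; apply/orthomx_spectralP/hermitian_normalmx.
Qed.

Lemma diag_quad_form n (D : 'rV[C]_n) (v : 'cV[C]_n) :
  (v^t* *m diag_mx D *m v) 0 0 = \sum_i D 0 i * `|v i 0| ^+ 2.
Proof.
rewrite mxE; apply: eq_bigr => i _; rewrite mul_mx_diag !mxE normCK.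
by rewrite mulrAC mulrC [v i 0 * _]mulrC mulrA.
Qed.

(** Rescaling the columns of the unitary diagonalization by the square roots of
    the eigenvalues; these are nonnegative, being values of the quadratic form
    at the eigenvectors. *)
Lemma psd_factor n (A : 'M[C]_n) : A^t* = A ->
  (forall v : 'cV[C]_n, 0 <= (v^t* *m A *m v) 0 0) ->
  exists L : 'M[C]_n, A = L *m L^t* .
Proof.
move=> /hermitian_spectral [P [D [PP PP' Dr ->]]] psd.
have D0 i : 0 <= D 0 i.
  (* [P^t* *m delta_mx i 0] is the eigenvector of [D 0 i]. *)
  have := psd (P^t* *m delta_mx i 0).
  rewrite trmxCM trmxCK !mulmxA -[_ *m P *m P^t*]mulmxA PP' mulmx1.
  rewrite -[_ *m P *m P^t*]mulmxA PP' mulmx1 diag_quad_form (bigD1 i)//= big1.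
    by rewrite addr0 mxE !eqxx normr1 expr1n mulr1.
  by move=> j ji; rewrite mxE (negPf ji) normr0 expr0n mulr0.
pose d : 'rV[C]_n := \row_i sqrtC (D 0 i).
exists (P^t* *m diag_mx d).
have -> : diag_mx D = diag_mx d *m (diag_mx d)^t* .
  rewrite tr_diag_mx map_diag_mx mulmx_diag; congr diag_mx.
  apply/rowP => i; rewrite !mxE.
  rewrite [X in _ * X](_ : _ = sqrtC (D 0 i)).
    by rewrite -expr2 sqrtCK.
  by apply: geC0_conj; rewrite sqrtC_ge0.
by rewrite trmxCM trmxCK !mulmxA.
Qed.

Section Functional.
Variables (n : nat) (B : 'M[C]_n.+1) (BH : B^t* = B).

Lemma horner_spectral : exists (P : 'M[C]_n.+1) (D : 'rV[C]_n.+1),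
  [/\ P^t* *m P = 1%:M, P *m P^t* = 1%:M,
    forall i, D 0 i \is Num.real &
    forall f, horner_mx B f = P^t* *m diag_mx (map_mx (horner f) D) *m P].
Proof.
have [P [D [PP PP' Dr BE]]] := hermitian_spectral BH.
exists P, D; split => // f.
have BP : B *m P^t* = P^t* *m diag_mx D by rewrite BE -mulmxA PP' mulmx1.
by rewrite -horner_mx_diag -(horner_mx_intertwine f BP) -mulmxA PP mulmx1.
Qed.

Lemma horner_hermitian_unit (f : {poly C}) :
  (forall t, t \is Num.real -> f.[t] != 0) -> horner_mx B f \in unitmx.
Proof.
move=> f0; have [P [D [PP PP' Dr ->]]] := horner_spectral.
have [PtU PU] := mulmx1_unit PP; rewrite !unitmx_mul PtU PU andbT /= unitmxE.
rewrite det_diag unitfE; apply/prodf_neq0 => i _; rewrite mxE; exact/f0/Dr.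
Qed.

Lemma horner_hermitian_psd (f : {poly C}) (v : 'cV[C]_n.+1) :
  (forall t, t \is Num.real -> 0 <= f.[t]) ->
  0 <= (v^t* *m horner_mx B f *m v) 0 0.
Proof.
move=> f0; have [P [D [PP PP' Dr ->]]] := horner_spectral.
have -> : v^t* *m (P^t* *m diag_mx (map_mx (horner f) D) *m P) *m v =
    (P *m v)^t* *m diag_mx (map_mx (horner f) D) *m (P *m v).
  by rewrite trmxCM !mulmxA.
rewrite diag_quad_form; apply: sumr_ge0 => i _.
by rewrite mxE mulr_ge0 ?exprn_ge0//; exact/f0/Dr.
Qed.

End Functional.
End Hermitian.

(** * The Hermitian model of the product of two real symmetric matrices *)

Section Complexification.
Variable K : realType.
Notation C := (complex.complex K).
Notation iota := (complex.real_complex K).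
Notation toC := (map_mx iota).
Local Open Scope sesquilinear_scope.

Lemma toC_trC m n (A : 'M[K]_(m, n)) : (toC A)^t* = toC A^T.
Proof.
apply/matrixP => i j; rewrite !mxE; apply/CrealP.
by apply/complex.complex_realP; exists (A j i).
Qed.

(** For [v = a + i b] the Hermitian form is [a^T A a + b^T A b]: by symmetry of
    [A] the two cross terms cancel. *)
Lemma psdmx_toC n (A : 'M[K]_n) (v : 'cV[C]_n) : A = A^T -> psdmx A ->
  0 <= (v^t* *m toC A *m v) 0 0.
Proof.
move=> Asym Apsd.
pose a := map_mx (@complex.Re K) v; pose b := map_mx (@complex.Im K) v.
have vE : v = toC a + 'i *: toC b.
  by apply/matrixP => i j; rewrite !mxE [LHS]complex.complexE.
have vCE : v^t* = toC a^T - 'i *: toC b^T.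
  rewrite vE linearD linearZ /= map_mxD map_mxZ /= !toC_trC.
  by rewrite -[RHS]/(_ + _) -scaleNr -conjCi.
have -> : v^t* *m toC A *m v = toC (a^T *m A *m a + b^T *m A *m b).
  rewrite vCE vE.
  have ab : a^T *m A *m b = b^T *m A *m a.
    rewrite [LHS](_ : _ = (a^T *m A *m b)^T); last first.
      by apply/matrixP => i j; rewrite [RHS]mxE !ord1.
    by rewrite !trmx_mul trmxK -Asym mulmxA.
  rewrite mulmxBl mulmxDr !mulmxBl -!scalemxAl -!scalemxAr scalerA.
  rewrite -!map_mxM ab -expr2 sqrCi scaleN1r opprK /= map_mxD.
  by rewrite addrA subrK.
by rewrite mxE complex.ler0c mxE addr_ge0.
Qed.

Variables (n : nat) (R S : 'M[K]_n.+1) (c : K).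
Hypotheses (Rsym : R = R^T) (Rpsd : psdmx R) (Ssym : S = S^T) (c0 : 0 <= c).
Let Z := - c *: (R *m S *m R *m S).

(** Write [R = L L^*] and put [B = L^* S L], which is Hermitian. Then
    [Z L = L (- c B^2)], so that on the range of [L] every polynomial in the
    non-symmetric [Z] becomes a polynomial in [B], namely its composition with
    [- c X^2], whose values at real points are values of the original
    polynomial on the negative half-line. *)
Lemma hermitian_model : exists L B : 'M[C]_n.+1,
  [/\ toC R = L *m L^t*, B^t* = B,
    exists N, toC Z = L *m N &
    forall f : {poly K}, toC (horner_mx Z f) *m L =
      L *m horner_mx B (map_poly iota (f \Po (- c *: 'X^2)))].
Proof.
have [| |L RE] := @psd_factor C _ (toC R).
- by rewrite toC_trC -Rsym.
- by move=> v; exact: psdmx_toC.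
exists L, (L^t* *m toC S *m L); split => //.
- by rewrite !trmxCM trmxCK toC_trC -Ssym mulmxA.
- exists (iota (- c) *: (L^t* *m toC S *m L *m L^t* *m toC S)).
  by rewrite map_mxZ !map_mxM RE -scalemxAr !mulmxA.
- move=> f; rewrite map_horner_mx map_comp_poly horner_mx_comp.
  apply: horner_mx_intertwine.
  rewrite map_polyZ map_polyXn horner_mxZ rmorphXn /= horner_mx_X.
  rewrite map_mxZ !map_mxM RE -scalemxAl -scalemxAr.
  by rewrite expr2 -[_ * _]/(_ *m _) !mulmxA.
Qed.

Let real_horner (f : {poly K}) (t : C) : t \is Num.real ->
  exists2 z : K, z <= 0 &
    (map_poly iota (f \Po (- c *: 'X^2))).[t] = iota f.[z].
Proof.
move=> /complex.complex_realP [k ->]; exists (- c * k ^+ 2).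
  by rewrite mulNr oppr_le0 mulr_ge0 ?sqr_ge0.
by rewrite [LHS]horner_map horner_comp !hornerE.
Qed.

(** The form [v^T f(Z) R v = v^* f(Z) L L^* v] is the form of [f(- c B^2)] at
    [L^* v], and [f(- c B^2)] has nonnegative spectrum. *)
Lemma horner_psd (f : {poly K}) : (forall z, z <= 0 -> 0 <= f.[z]) ->
  psdmx (horner_mx Z f *m R).
Proof.
move=> f0 v; have [L [B [RE BH _ fE]]] := hermitian_model.
rewrite -complex.ler0c.
have -> : complex.real_complex K ((v^T *m (horner_mx Z f *m R) *m v) 0 0) =
    (toC (v^T *m (horner_mx Z f *m R) *m v)) 0 0 by rewrite [RHS]mxE.
rewrite !map_mxM RE [X in _ *m X *m _]mulmxA fE -toC_trC.
have -> : (toC v)^t* *m (L *m horner_mx B (map_poly iota (f \Po (- c *: 'X^2)))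
      *m L^t*) *m toC v = (L^t* *m toC v)^t* *m
      horner_mx B (map_poly iota (f \Po (- c *: 'X^2))) *m (L^t* *m toC v).
  by rewrite trmxCM trmxCK !mulmxA.
apply: horner_hermitian_psd => // t /(real_horner f) [z z0 ->].
by rewrite complex.ler0c f0.
Qed.

(** The intertwining only sees the range of [L]; what is left over is killed by
    [Z]. Indeed a row vector [u] with [u f(Z) = 0] satisfies
    [u L f(- c B^2) = 0], hence [u L = 0], hence [u Z = 0] because [L] is a left
    factor of [Z]; then [u f(Z) = f(0) u], so [u = 0]. *)
Lemma horner_unit (f : {poly K}) : (forall z, z <= 0 -> f.[z] != 0) ->
  horner_mx Z f \in unitmx.
Proof.
move=> f0; have [L [B [RE BH [N ZE] fE]]] := hermitian_model.
have fBU : horner_mx B (map_poly iota (f \Po (- c *: 'X^2))) \in unitmx.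
  apply: horner_hermitian_unit => // t /(real_horner f) [z z0 ->].
  by rewrite fmorph_eq0 f0.
rewrite -(map_unitmx iota) -row_free_unit -kermx_eq0.
(* The rows of [U] span the left kernel of [f(Z)]. *)
set U := kermx _; have U0 : U *m toC (horner_mx Z f) = 0 by exact: mulmx_ker.
have UL : U *m L = 0.
  apply: (can_inj (mulmxK fBU)).
  by rewrite mul0mx -mulmxA -fE mulmxA U0 mul0mx.
have UZ : (0 : 'M[C]_n.+1) *m U = U *m toC Z.
  by rewrite ZE (mulmxA U) UL !mul0mx.
have := horner_mx_intertwine (map_poly iota f) UZ.
rewrite -map_horner_mx U0 horner_mx0 -[X in (map_poly _ _).[X]](rmorph0 iota) horner_map.
rewrite mul_scalar_mx => /eqP; rewrite scaler_eq0 fmorph_eq0.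
by rewrite (negPf (f0 0 (lexx 0))).
Qed.
End Complexification.

(** * Symmetry of second derivatives *)

Section Schwarz.
Variables (K : realType) (V : normedModType K).

Lemma is_derive_line (f : V -> K) (y v : V) (s : K) :
  derivable f (y + s *: v) v ->
  is_derive s 1 (fun t : K => f (y + t *: v)) ('D_v f (y + s *: v)).
Proof.
have E : (fun h : K => h^-1 *: (((fun t : K => f (y + t *: v)) \o shift s) (h *: 1)
      - f (y + s *: v))) =
    (fun h : K => h^-1 *: ((f \o shift (y + s *: v)) (h *: v) - f (y + s *: v))).
  apply/funext => h /=; congr (_ *: (f _ - _)).
  by rewrite scalerDl addrCA /GRing.scale /= mulr1.
move=> df; apply: DeriveDef; first by rewrite /derivable E.
by rewrite /derive E.
Qed.

Lemma directional_MVT (f : V -> K) (y v : V) (b : K) : 0 < b ->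
  (forall s, 0 <= s <= b -> derivable f (y + s *: v) v) ->
  exists2 s, 0 < s < b & f (y + b *: v) - f y = 'D_v f (y + s *: v) * b.
Proof.
move=> b0 df.
have [||s sb E] := @MVT K (fun t => f (y + t *: v))
    (fun t => 'D_v f (y + t *: v)) 0 b b0.
- move=> s; rewrite in_itv /= => /andP[/ltW s0 /ltW sb].
  by apply: is_derive_line; apply: df; rewrite s0.
- apply: derivable_within_continuous => s; rewrite in_itv /= => sb.
  exact/ex_derive/is_derive_line/df.
exists s; first by move: sb; rewrite in_itv.
by move: E; rewrite scale0r addr0 subr0.
Qed.

Lemma is_derive_translate (f : V -> K) (y w v : V) :
  derivable f (y + w) v ->
  is_derive y v (fun z => f (z + w)) ('D_v f (y + w)).
Proof.
have E : (fun h : K => h^-1 *: (((fun z => f (z + w)) \o shift y) (h *: v)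
      - f (y + w))) =
    (fun h : K => h^-1 *: ((f \o shift (y + w)) (h *: v) - f (y + w))).
  by apply/funext => h /=; rewrite addrA.
move=> df; apply: DeriveDef; first by rewrite /derivable E.
by rewrite /derive E.
Qed.

Definition second_diff (f : V -> K) (x a c : V) : K :=
  f (x + a + c) - f (x + a) - f (x + c) + f x.

Lemma second_diffC f x a c : second_diff f x a c = second_diff f x c a.
Proof. by rewrite /second_diff (addrAC x a c) [X in X + f x]addrAC. Qed.

(** The mean value theorem twice: once along [u] for the increment
    [z |-> f (z + b v) - f z], then along [v] for ['D_u f]. *)
Lemma second_diff_MVT (f : V -> K) (x u v : V) (b : K) : 0 < b ->
  (forall s t, 0 <= s <= b -> 0 <= t <= b ->
    derivable f (x + s *: u + t *: v) u /\
    derivable ('D_u f) (x + s *: u + t *: v) v) ->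
  exists s t, [/\ 0 < s < b, 0 < t < b &
    second_diff f x (b *: u) (b *: v) =
    'D_v ('D_u f) (x + s *: u + t *: v) * b ^+ 2].
Proof.
move=> b0 df; have bb : 0 <= b <= b by rewrite ltW /=.
have b00 : (0 : K) <= 0 <= b by rewrite lexx ltW.
pose g z := f (z + b *: v) - f z.
have dg s : 0 <= s <= b -> is_derive (x + s *: u) u g
    ('D_u f (x + s *: u + b *: v) - 'D_u f (x + s *: u)).
  move=> sb; apply: is_deriveB.
    apply: is_derive_translate; have [d _] := df s b sb bb; exact: d.
  apply: DeriveDef => //.
  by have [] := df s 0 sb b00; rewrite scale0r addr0.
have [s sb|s sb gE] := @directional_MVT g x u b b0.
  exact/ex_derive/dg.
have sb' : 0 <= s <= b by case/andP: sb => /ltW -> /ltW.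
have [t tb|t tb DE] := @directional_MVT ('D_u f) (x + s *: u) v b b0.
  by have [] := df s t sb' tb.
exists s, t; split => //; rewrite expr2 mulrA -DE.
have := @derive_val _ _ _ _ _ _ _ (dg s sb') => <-; rewrite -gE /g /second_diff.
by rewrite opprB addrA addrAC.
Qed.

(** Schwarz's theorem. The second difference is symmetric in its two increments,
    so it equals [b ^+ 2] times a value of either mixed derivative near [x];
    these two values agree, and continuity transports the equality to [x]. *)
Lemma mixed_derivatives_commute (U : set V) (f : V -> K) (x u v : V) :
  open U -> U x ->
  (forall y, U y -> [/\ derivable f y u, derivable f y v,
    derivable ('D_u f) y v & derivable ('D_v f) y u]) ->
  {for x, continuous ('D_v ('D_u f))} -> {for x, continuous ('D_u ('D_v f))} ->
  'D_v ('D_u f) x = 'D_u ('D_v f) x.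
Proof.
move=> Uo Ux df cuv cvu; apply/eqP; rewrite -subr_eq0 -normr_le0.
apply/ler_addgt0Pl => e e0; rewrite addr0.
have e2 : 0 < e / 2 by rewrite divr_gt0.
have Ux' : nbhs x U by exact: open_nbhs_nbhs.
move/cvgrPdist_lt : cuv => /(_ _ e2) cuv; move/cvgrPdist_lt : cvu => /(_ _ e2) cvu.
have : nbhs x (U `&`
    ([set y | `|'D_v ('D_u f) x - 'D_v ('D_u f) y| < e / 2] `&`
     [set y | `|'D_u ('D_v f) x - 'D_u ('D_v f) y| < e / 2])).
  apply: filterI; first exact: Ux'.
  by apply: filterI; [exact: cuv|exact: cvu].
move=> /nbhs_ballP [d /= d0 dP].
(* Small enough for the parallelogram spanned by [b u] and [b v] at [x] to lie
   in the ball of radius [d]. *)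
pose b := d / (`|u| + `|v| + 1) / 2.
have N0 : 0 < `|u| + `|v| + 1 by rewrite ltr_wpDl ?addr_ge0.
have b0 : 0 < b by rewrite !divr_gt0.
have near_x s t : 0 <= s <= b -> 0 <= t <= b -> ball x d (x + s *: u + t *: v).
  move=> /andP[s0 sb] /andP[t0 tb]; rewrite -ball_normE /= -addrA opprD addNKr normrN.
  apply: (le_lt_trans (ler_normD _ _)); rewrite !normrZ !ger0_norm//.
  apply: (@le_lt_trans _ _ (b * (`|u| + `|v| + 1))).
    rewrite !mulrDr mulr1 -[leLHS]addr0; apply: lerD; last exact: ltW.
    by apply: lerD; apply: ler_wpM2r.
  by rewrite /b mulrAC divfK ?gt_eqF// ltr_pdivrMr// ltr_pMr// ltr1n.
have near_x' t s : 0 <= t <= b -> 0 <= s <= b -> ball x d (x + t *: v + s *: u).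
  by move=> tb sb; rewrite addrAC; exact: near_x.
have [|s [t [sb tb E1]]] := @second_diff_MVT f x u v b b0.
  move=> s t sb tb; have [/df[d1 _ d2 _] _] := dP _ (near_x s t sb tb).
  by split; [exact: d1|exact: d2].
have [|t' [s' [tb' sb' E2]]] := @second_diff_MVT f x v u b b0.
  move=> t' s' tb' sb'; have [/df[_ d1 _ d2] _] := dP _ (near_x' _ _ tb' sb').
  by split; [exact: d1|exact: d2].
have weak r : 0 < r < b -> 0 <= r <= b by case/andP => /ltW -> /ltW.
have [_ [/= A _]] := dP _ (near_x s t (weak _ sb) (weak _ tb)).
have [_ [_ /= B]] := dP _ (near_x' _ _ (weak _ tb') (weak _ sb')).
move: E1 A E2 B; set z := x + _ + _; set z' := x + _ + _ => E1 A E2 B.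
have EQ : 'D_v ('D_u f) z = 'D_u ('D_v f) z'.
  apply: (mulIf (lt0r_neq0 (exprn_gt0 2 b0))).
  exact: etrans (esym E1) (etrans (second_diffC _ _ _ _) E2).
rewrite EQ in A; rewrite distrC in B.
apply: ltW; apply: (le_lt_trans (ler_distD ('D_u ('D_v f) z') _ _)).
by rewrite (splitr e); apply: ltrD; [exact: A|exact: B].
Qed.

End Schwarz.

Lemma hessian_sym (K : realType) n (U : set 'cV[K]_n.+1) (H : 'cV[K]_n.+1 -> K) x :
  open U -> C2_open U H -> U x -> hessian H x = (hessian H x)^T.
Proof.
move=> Uo H2 Ux; apply/matrixP => i j; rewrite !mxE /partial.
have [_ _ _ _ ct] := H2 x Ux.
apply: (mixed_derivatives_commute Uo Ux); [|exact: ct..].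
by move=> y /H2 [_ d1 _ d2 _]; split; [exact: d1|exact: d1|exact: d2|exact: d2].
Qed.

(** * Norm estimates for polynomials and rational functions of matrices *)

Section Norms.
Variable K : realType.

Lemma mx_norm_leP m n (A : 'M[K]_(m, n)) (b : K) : 0 <= b ->
  reflect (forall i j, `|A i j| <= b) (`|A| <= b).
Proof.
move=> b0; rewrite /Num.norm /= mx_normrE; apply: (iffP (bigmax_leP _ _ _ _)).
  by move=> [_ Ab] i j; exact: (Ab (i, j)).
by move=> Ab; split => // -[i j] _; exact: Ab.
Qed.

Lemma norm_coord_le m n (A : 'M[K]_(m, n)) i j : `|A i j| <= `|A|.
Proof. by move: i j; apply/mx_norm_leP. Qed.

Lemma ler_norm_mulmx m n k (A : 'M[K]_(m, n)) (B : 'M[K]_(n, k)) :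
  `|A *m B| <= n%:R * `|A| * `|B|.
Proof.
apply/mx_norm_leP => [|i j]; first by rewrite !mulr_ge0.
rewrite mxE; apply: (le_trans (ler_norm_sum _ _ _)).
apply: (@le_trans _ _ (\sum_(l < n) `|A| * `|B|)).
  apply: ler_sum => l _; rewrite normrM ler_pM//.
    exact: norm_coord_le.
  exact: norm_coord_le.
by rewrite sumr_const card_ord -[leLHS]mulr_natl mulrA.
Qed.

Variable n : nat.
Implicit Types (M : 'M[K]_n.+1) (f p q : {poly K}).

Lemma horner_mx_bounded f : exists2 C : K, 0 <= C &
  forall M, `|M| <= 1 -> `|horner_mx M f| <= C.
Proof.
elim/poly_ind: f => [|f c [C C0 fC]].
  by exists 0 => // M _; rewrite rmorph0 normr0.
exists (n.+1%:R * C + `|c%:M : 'M[K]_n.+1|); first by rewrite addr_ge0 ?mulr_ge0.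
move=> M M1; rewrite rmorphD rmorphM /= horner_mx_X horner_mx_C.
rewrite (le_trans (ler_normD _ _))// lerD2r (le_trans (ler_norm_mulmx _ _))//.
by rewrite -mulrA ler_wpM2l// -[leRHS]mulr1 ler_pM// fC.
Qed.

(** With [q = q(0) + X t], the inverse [G] of [q(M)] satisfies
    [G = q(0)^-1 (1 - t(M) M G)]; for small [M] the last term has norm at most
    half that of [G] and is absorbed in the left-hand side. *)
Lemma horner_mx_inv_bounded q : q.[0] != 0 -> exists C e : K,
  [/\ 0 <= C, 0 < e & forall M, `|M| <= e -> horner_mx M q \in unitmx ->
    `|invmx (horner_mx M q)| <= C].
Proof.
move=> q0; have /factor_theorem [t tE] : root (q - q.[0]%:P) 0.
  by rewrite rootE !hornerE subrr.
rewrite subr0 in tE.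
have [T T0 tT] := horner_mx_bounded t.
pose N : K := n.+1%:R; have N0 : 0 < N by rewrite ltr0n.
pose a := q.[0]^-1; have a0 : 0 < `|a| by rewrite normr_gt0 invr_eq0.
pose w := `|a| * N * N * T + 1.
have w0 : 0 < w by rewrite ltr_wpDl// !mulr_ge0// ltW.
(* The radius makes [|a| |t(M) M G| <= |G| / 2], the two factors [N] coming from
   the matrix products. *)
exists (2 * (`|a| * `|1%:M : 'M[K]_n.+1|)), (Num.min 1 (w^-1 / 2)); split.
- by rewrite !mulr_ge0.
- by rewrite lt_min ltr01 divr_gt0 ?invr_gt0.
move=> M; rewrite le_min => /andP[M1 Mw] qU.
set G := invmx _.
have qE : horner_mx M q = horner_mx M t *m M + q.[0]%:M.
  have -> : q = t * 'X + q.[0]%:P by rewrite -tE subrK.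
  by rewrite rmorphD rmorphM /= horner_mx_X horner_mx_C ?hornerE ?mulr0 ?add0r.
have GE : G = a *: (1%:M - horner_mx M t *m M *m G).
  have : (horner_mx M t *m M + q.[0]%:M) *m G = 1%:M by rewrite -qE mulmxV.
  rewrite mulmxDl mul_scalar_mx => <-.
  by rewrite addrAC subrr add0r scalerA mulVf// scale1r.
have small : `|horner_mx M t *m M *m G| <= N * N * T * (w^-1 / 2) * `|G|.
  rewrite (le_trans (ler_norm_mulmx _ _))// ler_wpM2r//.
  rewrite -!mulrA ler_wpM2l//.
  rewrite (le_trans (ler_norm_mulmx _ _))// -mulrA ler_wpM2l//.
  by rewrite ler_pM// tT.
have : `|G| <= `|a| * (`|1%:M : 'M[K]_n.+1| + N * N * T * (w^-1 / 2) * `|G|).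
  rewrite {1}GE normrZ ler_wpM2l// (le_trans (ler_normB _ _))// lerD2l//.
have : `|a| * (N * N * T * (w^-1 / 2)) <= 1 / 2.
  have -> : `|a| * (N * N * T * (w^-1 / 2)) = `|a| * N * N * T / w / 2.
    by rewrite !mulrA.
  by rewrite ler_pM2r// ler_pdivrMr// mul1r lerDl ler01.
have := normr_ge0 G; nra.
Qed.

(** From [1 + z <= exp z] at [z] and at [- z]. *)
Lemma expR_taylor1 (z : K) : `|z| <= 1 / 2 -> `|expR z - 1 - z| <= 2 * z ^+ 2.
Proof.
move=> z12; have z1 : z <= 1 / 2 by rewrite (le_trans (ler_norm z)).
have := expR_ge1Dx z; have := expR_ge1Dx (- z) => A B.
have C : expR z * (1 - z) <= 1.
  rewrite -[leRHS](expR0 K) -(subrr z) expRD ler_wpM2l// ltW// expR_gt0.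
have := expR_gt0 z => D.
rewrite ger0_norm; last lra.
nra.
Qed.

(** Evaluating the bound at [0] gives a first root; after division by [X] the
    bound becomes linear and its limit at [0] gives the second. *)
Lemma poly_O2 f (C : K) : (\forall z \near (0 : K), `|f.[z]| <= C * z ^+ 2) ->
  exists s, f = s * 'X^2.
Proof.
move=> fC; have f0 : root f 0.
  have := nbhs_singleton fC.
  by rewrite expr0n mulr0 normr_le0.
have [g fE] := factor_theorem _ _ f0; rewrite subr0 in fE.
suff g0 : root g 0.
  have [s gE] := factor_theorem _ _ g0; rewrite subr0 in gE.
  by exists s; rewrite fE gE expr2 mulrA.
have gc : `|g.[z]| @[z --> (0 : K)^'+] --> `|g.[0]|.
  apply: cvg_at_right_filter; apply: cvg_norm; exact: continuous_horner.
have lc : (C%:P * 'X).[z] @[z --> (0 : K)^'+] --> (C%:P * 'X).[0].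
  by apply: cvg_at_right_filter; exact: continuous_horner.
rewrite rootE -normr_le0; suff : `|g.[0]| <= (C%:P * 'X).[0].
  by rewrite !hornerE ?mulr0.
apply: (ler_cvg_to gc lc).
have fC' : \forall z \near (0 : K)^'+, `|f.[z]| <= C * z ^+ 2.
  by apply: cvg_within; exact: fC.
have pos : \forall z \near (0 : K)^'+, 0 < z by exact: nbhs_right_gt.
apply: filterS2 fC' pos => z + z0.
rewrite fE !hornerM hornerC hornerX normrM (gtr0_norm z0) expr2 mulrA.
by rewrite ler_pM2r.
Qed.

(** The order condition in algebraic form: [p - (1 + X) q] is a polynomial and
    [O(z^2)] at [0], so [X^2] divides it. This is what allows the condition to be
    evaluated at a matrix. *)
Lemma ratfun_taylor p q : q.[0] != 0 ->
  ratfun p q = expR +O_ (0 : K) (fun z : K => z ^+ 2) ->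
  exists s, p = q * (1 + 'X) + s * 'X^2.
Proof.
move=> q0 /eqaddOP /bigO_exP [k k0 kP].
have qc : q.[z] @[z --> (0 : K)] --> q.[0] by exact: continuous_horner.
have qn0 : \forall z \near (0 : K), q.[z] != 0.
  exact: (@cvgr_neq0 K K^o _ _ _ (horner q) _ qc q0).
have qb : \forall z \near (0 : K), `|q.[z]| <= `|q.[0]| + 1.
  by apply: (@cvgr_norm_le K K^o _ _ _ (horner q) _ qc); rewrite ltrDl.
have z12 : \forall z \near (0 : K), `|z| <= 1 / 2.
  by apply: (@nbhs0_le K K^o); rewrite divr_gt0.
have [s sE] : exists s, p - q * (1 + 'X) = s * 'X^2.
  apply: (@poly_O2 _ ((`|q.[0]| + 1) * (k + 2))).
  apply: filterS2 (filterI kP qn0) (filterI qb z12) => z [/= kz qz] [qbz zz].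
  have -> : (p - q * (1 + 'X)).[z] =
      q.[z] * ((ratfun p q z - expR z) + (expR z - 1 - z)).
    rewrite !(hornerD, hornerN, hornerM, hornerX) -[1]polyC1 hornerC /ratfun.
    by field.
  rewrite normrM -mulrA ler_pM// mulrDl (le_trans (ler_normD _ _))// lerD//.
    by move: kz; rewrite normrX real_normK// num_real.
  exact: expR_taylor1.
by exists s; rewrite -sE addrC subrK.
Qed.

(** [r(M) - (1 + M) = q(M)^-1 s(M) M^2]. *)
Lemma ratmx_remainder p q s : q.[0] != 0 -> p = q * (1 + 'X) + s * 'X^2 ->
  exists C e : K, [/\ 0 <= C, 0 < e & forall M, `|M| <= e ->
    horner_mx M q \in unitmx ->
    `|ratmx p q M - (1%:M + M)| <= C * `|M| ^+ 2].
Proof.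
move=> q0 pE; have [G [e [G0 e0 qG]]] := horner_mx_inv_bounded q0.
have [S S0 sS] := horner_mx_bounded s.
pose N : K := n.+1%:R.
exists (N * G * (N * (N * S))), (Num.min 1 e); split.
- by rewrite !mulr_ge0.
- by rewrite lt_min ltr01.
move=> M; rewrite le_min => /andP[M1 Me] qU.
have -> : ratmx p q M - (1%:M + M) =
    invmx (horner_mx M q) *m (horner_mx M s *m M *m M).
  rewrite /ratmx pE !(rmorphD, rmorphM, rmorph1, rmorphXn) /= !horner_mx_X.
  rewrite mulmxDr [_ * (1 + M)]/(_ *m _) mulmxA mulVmx// mul1mx.
  by rewrite addrAC subrr add0r -[_ * _]/(_ *m _) !mulmxA.
rewrite (le_trans (ler_norm_mulmx _ _))// -/N -!mulrA ler_wpM2l//.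
rewrite ler_pM//; first exact: qG.
rewrite (le_trans (ler_norm_mulmx _ _))// -/N -!mulrA ler_wpM2l// expr2.
rewrite !mulrA ler_wpM2r//.
rewrite (le_trans (ler_norm_mulmx _ _))// -/N ler_wpM2r// ler_wpM2l//.
exact: sS.
Qed.

End Norms.

(** * The completion *)

Section Completion.
Variables (K : realType) (n : nat).
Implicit Types (R S : 'M[K]_n.+1) (p q : {poly K}).

Lemma horner_mx_sym (A R : 'M[K]_n.+1) (f : {poly K}) :
  A *m R = R *m A^T -> horner_mx A f *m R = R *m (horner_mx A f)^T.
Proof. by rewrite horner_mx_tr; exact: horner_mx_intertwine. Qed.

(** [q(A)^-1 p(A) R = q(A)^-1 R p(A)^T = R q(A)^-T p(A)^T], and the transpose of
    the first expression is [R p(A)^T q(A)^-T]. *)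
Lemma ratmx_mul_sym (A R : 'M[K]_n.+1) p q : R = R^T -> A *m R = R *m A^T ->
  horner_mx A q \in unitmx -> ratmx p q A *m R = (ratmx p q A *m R)^T.
Proof.
move=> Rsym AR qU; rewrite /ratmx !trmx_mul -Rsym.
have qTU : (horner_mx A q)^T \in unitmx by rewrite unitmx_tr.
have := comm_horner_mx2 A p q; rewrite /GRing.comm => pq.
rewrite -mulmxA (horner_mx_sym p AR).
apply: (can_inj (mulKmx qU)); rewrite mulKVmx//.
apply: (can_inj (mulmxK qTU)).
have pqT : (horner_mx A p)^T *m (horner_mx A q)^T =
    (horner_mx A q)^T *m (horner_mx A p)^T.
  by rewrite -!trmx_mul; congr (_^T).
rewrite -!mulmxA -(trmx_mul (horner_mx A q) (invmx _)) mulmxV// trmx1 mulmx1.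
by rewrite [RHS]mulmxA (horner_mx_sym q AR) -mulmxA pqT.
Qed.

(** With [v = q(A)^T w], the form of [r(A) R] at [v] is the form of
    [p(A) R q(A)^T = (p q)(A) R] at [w]. *)
Lemma ratmx_mul_psd (A R : 'M[K]_n.+1) p q : A *m R = R *m A^T ->
  horner_mx A q \in unitmx -> psdmx (horner_mx A (p * q) *m R) ->
  psdmx (ratmx p q A *m R).
Proof.
move=> AR qU psd v.
have qTU : (horner_mx A q)^T \in unitmx by rewrite unitmx_tr.
pose w := invmx (horner_mx A q)^T *m v.
suff <- : w^T *m (horner_mx A (p * q) *m R) *m w = v^T *m (ratmx p q A *m R) *m v.
  exact: psd.
rewrite /w trmx_mul trmx_inv trmxK rmorphM /= -[_ * _]/(_ *m _).
rewrite -(mulmxA (horner_mx A p)) (horner_mx_sym q AR).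
by rewrite /ratmx !mulmxA mulmxK.
Qed.

Lemma hessian_bounded (U : set 'cV[K]_n.+1) H m :
  C2_open U H -> U m -> exists2 C : K, 0 <= C & \forall x \near m, `|hessian H x| <= C.
Proof.
move=> H2 Um; have [_ _ _ _ ct] := H2 m Um.
exists (`|hessian H m| + 1); first by rewrite addr_ge0.
have near_ij (ij : 'I_n.+1 * 'I_n.+1) :
    \forall x \near m, `|hessian H x ij.1 ij.2| <= `|hessian H m| + 1.
  have := @cvgr_norm_le K K^o _ _ _ _ _ (ct ij.1 ij.2) (`|hessian H m| + 1).
  have lt : `|partial ij.1 (partial ij.2 H) m| < `|hessian H m| + 1.
    have := norm_coord_le (hessian H m) ij.1 ij.2; rewrite mxE.
    by move=> /le_lt_trans; apply; rewrite ltrDl.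
  by move=> /(_ _ lt); apply: filterS => x; rewrite mxE.
apply: filterS (filter_forall _ near_ij) => x xij.
by apply/mx_norm_leP => [|i j]; [rewrite addr_ge0|exact: (xij (i, j))].
Qed.

Lemma midpoint_cvg (z0 : 'cV[K]_n.+1 * 'cV[K]_n.+1) :
  midpoint z.1 z.2 @[z --> z0] --> midpoint z0.1 z0.2.
Proof.
apply: cvgZ; first exact: cvg_cst.
by apply: cvgD; [exact: cvg_fst|exact: cvg_snd].
Qed.

Lemma near_midpoint (z0 : 'cV[K]_n.+1 * 'cV[K]_n.+1) (P : set 'cV[K]_n.+1) :
  (\forall m \near midpoint z0.1 z0.2, P m) ->
  \forall z \near z0, P (midpoint z.1 z.2).
Proof. exact: midpoint_cvg. Qed.

Lemma norm_RSRS R S (C : K) : `|S| <= C ->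
  `|R *m S *m R *m S| <= n.+1%:R ^+ 3 * `|R| ^+ 2 * C ^+ 2.
Proof.
move=> SC; have C0 : 0 <= C by exact: le_trans SC.
have RS : `|R *m S| <= n.+1%:R * `|R| * C.
  by rewrite (le_trans (ler_norm_mulmx _ _))// ler_wpM2l ?mulr_ge0.
rewrite -mulmxA (le_trans (ler_norm_mulmx _ _))//.
have -> : n.+1%:R ^+ 3 * `|R| ^+ 2 * C ^+ 2 =
    n.+1%:R * (n.+1%:R * `|R| * C) * (n.+1%:R * `|R| * C) by ring.
by rewrite ler_pM ?mulr_ge0// ler_wpM2l.
Qed.

Lemma Zmx_mul_sym R (H : 'cV[K]_n.+1 -> K) x h : R = R^T ->
  hessian H x = (hessian H x)^T -> Zmx R H x h *m R = R *m (Zmx R H x h)^T.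
Proof.
move=> Rsym Ssym; rewrite /Zmx [_^T]linearZ /= !trmx_mul -Rsym -Ssym.
by rewrite -scalemxAl -scalemxAr !mulmxA.
Qed.

End Completion.

Unset Implicit Arguments.

Theorem theorem8 (K : realType) (n : nat) (R : 'M[K]_n.+1)
    (X : set 'cV[K]_n.+1) (H : 'cV[K]_n.+1 -> K) (p q : {poly K})
    (R_sym : R = R^T) (R_psd : psdmx R)
    (H_C2 : C2_on X H)
    (pq_lowest : coprimep p q)
    (r_nopole : forall z : K, z <= 0 -> ~~ root q z)
    (r_exp : ratfun p q = expR +O_ (0 : K) (fun z : K => z ^+ 2))
    (r_ge0 : forall z : K, z <= 0 -> 0 <= ratfun p q z) :
  (forall (x y : 'cV[K]_n.+1) (h : K), admissible X (x, y) -> 0 < h ->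
     horner_mx (Zmx R H (midpoint x y) h) q \in unitmx) /\
  sym_psd_completion4 X (Rtilde R H) (Rrat p q R H).
Proof.
have [U [Uo XU H2]] := H_C2.
have Ssym m : X m -> hessian H m = (hessian H m)^T.
  by move=> Xm; apply: (hessian_sym Uo H2); exact: XU.
have c0 (h : K) : 0 <= h ^+ 2 / 12%:R by rewrite divr_ge0// sqr_ge0.
have qU m h : X m -> horner_mx (Zmx R H m h) q \in unitmx.
  move=> /Ssym Sm; exact: (horner_unit R_sym R_psd Sm (c0 h) r_nopole).
split; first by move=> x y h [_ _ Xm] _; exact: qU.
split.
  move=> x y h [_ _ Xm] _; have AR := Zmx_mul_sym h R_sym (Ssym _ Xm); split.
    exact: ratmx_mul_sym (qU _ _ Xm).
  apply: ratmx_mul_psd => //; first exact: qU.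
  apply: (horner_psd R_sym R_psd (Ssym _ Xm) (c0 h)) => z z0.
  have qz : q.[z] != 0 by exact: r_nopole.
  (* [p q] has the sign of [r], and unlike [r] it is a polynomial. *)
  have -> : (p * q).[z] = ratfun p q z * q.[z] ^+ 2.
    by rewrite hornerM /ratfun expr2 mulrA divfK.
  by rewrite mulr_ge0 ?sqr_ge0 ?r_ge0.
have q0 : q.[0] != 0 by exact: r_nopole.
have [s pE] := ratfun_taylor q0 r_exp.
have [C [e [C0 e0 rem]]] := ratmx_remainder n q0 pE.
move=> [x0 y0] [_ _ /= /XU Um0].
have [S0 S00 Sb] := hessian_bounded H2 Um0.
pose b : K := n.+1%:R ^+ 3 * `|R| ^+ 2 * S0 ^+ 2 / 12%:R.
have b0 : 0 <= b by rewrite divr_ge0// !mulr_ge0 ?exprn_ge0.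
exists (n.+1%:R * (C * b ^+ 2) * `|R|).
have near_z : \forall z \near (x0, y0), `|hessian H (midpoint z.1 z.2)| <= S0.
  exact: (@near_midpoint K n (x0, y0) _ Sb).
(* For [h <= d] both [h <= 1] and [h * b <= e] hold, whence [h ^+ 2 * b <= e]. *)
pose d := Num.min 1 (e / (b + 1)).
have d0 : 0 < d by rewrite lt_min ltr01 divr_gt0// ltr_wpDl.
exists ([set z | admissible X z /\ `|hessian H (midpoint z.1 z.2)| <= S0],
        [set h | 0 < h /\ h <= d]) => /=.
  split.
    by apply: filterS near_z => z zS Dz.
  apply: filterI; first exact: nbhs_right_gt.
  exact: nbhs_right_le.
move=> [[x y] h] /= [[[_ _ /= Xm] zS] [h0 hd]].
(* The target is exactly the first-order Taylor polynomial of the exponential at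
   [Z], multiplied by [R]. *)
have ZE : Rtilde R H x y h = (1%:M + Zmx R H (midpoint x y) h) *m R.
  by rewrite mulmxDl mul1mx /Zmx -scalemxAl scaleNr.
rewrite ZE /Rrat -mulmxBl.
set Z := Zmx _ _ _ _.
have Zb : `|Z| <= h ^+ 2 * b.
  have -> : h ^+ 2 * b =
      h ^+ 2 / 12%:R * (n.+1%:R ^+ 3 * `|R| ^+ 2 * S0 ^+ 2).
    by rewrite /b mulrA mulrAC.
  by rewrite /Z /Zmx normrZ normrN ger0_norm// ler_wpM2l// norm_RSRS.
have Ze : `|Z| <= e.
  apply: (le_trans Zb).
  have := hd; rewrite le_min => /andP[h1 he].
  have : h * (b + 1) <= e by rewrite -ler_pdivlMr// ltr_wpDl.
  nra.
have -> : n.+1%:R * (C * b ^+ 2) * `|R| * h ^+ 4 =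
    n.+1%:R * (C * (h ^+ 2 * b) ^+ 2) * `|R| by ring.
apply: (le_trans (ler_norm_mulmx _ _)).
rewrite ler_wpM2r// ler_wpM2l// (le_trans (rem Z Ze (qU _ _ Xm)))//.
by rewrite ler_wpM2l// !expr2 ler_pM.
Qed.
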